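(* Let $(X_k^{(i)})_{k\in\mathbb Z}$ and $(X_k^{(j)})_{k\in\mathbb Z}$ be independent stationary ergodic real-valued sequences with common marginal distribution function $F$. For $r\in\{i,j\}$ define $$\hat\mu_n^{(r)}=\frac1n\sum_{k=1}^n\delta_{X_k^{(r)}},\qquad F_n^{(r)}(t)=\hat\mu_n^{(r)}((-\infty,t]),\qquad W_{ij,n}:=W_1(\hat\mu_n^{(i)},\hat\mu_n^{(j)}).$$ Assume the joint convergence in distribution $$\Bigl(\sqrt n\,(F_n^{(i)}-F),\ \sqrt n\,(F_n^{(j)}-F)\Bigr)\to\bigl(G^{(i)},G^{(j)}\bigr)\quad\text{in }L^1(\mathbb R)\times L^1(\mathbb R),$$ where $(G^{(i)},G^{(j)})$ is centered Gaussian, $G^{(i)}$ and $G^{(j)}$ are independent copies of one another, and each $G^{(r)}$ has the covariance structure: for all bounded measurable $f,g:\mathbb R\to\mathbb R$, $$\operatorname{Cov}\Bigl(\int f(t)G^{(r)}(t)\,dt,\int g(t)G^{(r)}(t)\,dt\Bigr)=\sum_{k\in\mathbb Z}\mathbb E\Bigl(\iint f(t)g(s)\bigl(\mathbf 1\{X^{(r)}_0\le t\}-F(t)\bigr)\bigl(\mathbf 1\{X^{(r)}_k\le s\}-F(s)\bigr)\,dt\,ds\Bigr).$$ Then, in distribution as $n\to\infty$, $$\sqrt n\,W_{ij,n}\to\int_{\mathbb R}\bigl|G^{(i)}(t)-G^{(j)}(t)\bigr|\,dt.$$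
   Context: $W_1$ is the 1-Wasserstein distance between probability measures on $\mathbb R$; $\delta_x$ is the Dirac measure at $x$; $L^1(\mathbb R)$ is taken with respect to Lebesgue measure. One may use that on $\mathbb R$, $W_1(\nu_1,\nu_2)=\int_{\mathbb R}|F_{\nu_1}(t)-F_{\nu_2}(t)|\,dt$ with $F_\nu$ the distribution function of $\nu$. *)

(* Defs.v *)
From HB Require Import structures.
From mathcomp Require Import all_boot all_order all_algebra.
From mathcomp Require Import all_classical all_reals all_analysis.
From mathcomp Require Import measurable_realfun ess_sup_inf.

Set Implicit Arguments.
Unset Strict Implicit.
Unset Printing Implicit Defensive.

Import Order.TTheory GRing.Theory Num.Theory.
Import numFieldNormedType.Exports.

Local Open Scope classical_set_scope.
Local Open Scope ring_scope.

(* The normed space structure of L^p(mu), the space of classes of functions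
   modulo equality almost everywhere. The library provides the type and, on
   representatives, the vector space structure and the seminorm. *)
Section LspaceNormed.
Context d (T : measurableType d) (R : realType).
Variables (mu : {measure set T -> \bar R}) (p : \bar R) (p1 : (1 <= p)%E).

Local Notation Lp := (LspaceType mu p1).
Local Notation Lf := (LfunType mu p1).

Lemma ae_eq_Lnorm (f g : T -> R) :
  measurable_fun setT f -> measurable_fun setT g -> f = g %[ae mu] ->
  ('N[mu]_p[EFin \o f] = 'N[mu]_p[EFin \o g])%E.
Proof.
move=> mf mg fg.
have fgE : ae_eq mu setT (abse \o (EFin \o f)) (abse \o (EFin \o g)).
  exact: (ae_eq_comp abse (ae_eq_comp EFin fg)).
have mabs (h : T -> R) : measurable_fun setT h ->
    measurable_fun setT (abse \o (EFin \o h) : T -> \bar R).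
  by move=> mh; apply: measurableT_comp => //; exact/measurable_EFinP.
rewrite unlock /Lnorm; case: p p1 => [r r1|_|//].
- congr (_ `^ _)%E; apply: ae_eq_integral => //.
  + exact: (measurableT_comp (measurable_poweR r) (mabs f mf)).
  + exact: (measurableT_comp (measurable_poweR r) (mabs g mg)).
  + exact: (ae_eq_comp (fun x => x `^ r)%E fgE).
- case: ifPn => // _; apply: eq_ess_sup.
  by apply: filterS fgE => x /(_ I).
Qed.

Lemma Lspace_Lfun (F : Lp) : (F : T -> R) \in Lfun mu p.
Proof.
apply/andP; split; rewrite inE/=; last exact: Lebesgue_finite.
exact: (@measurable_funPT _ _ _ _ (repr (LebesgueSpace.sort F))).
Qed.

Definition Lspace_repr (F : Lp) : Lf := Lfun_Sub p1 (Lspace_Lfun F).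

Definition mfun_class (f : {mfun T >-> measurableTypeR R}) :
    {mfun_ mu, T >-> measurableTypeR R} :=
  \pi_({mfun_ mu, T >-> measurableTypeR R})%qT f.

Lemma mfun_class_ae (f : {mfun T >-> measurableTypeR R}) :
  (mfun_class f : T -> R) = f %[ae mu].
Proof.
by have /eqmodP/asboolP := reprK (mfun_class f).
Qed.

Lemma measurable_funR (f : Lf) :
  (f : T -> measurableTypeR R) \in @mfun _ _ T (measurableTypeR R).
Proof. by rewrite inE; exact: (@measurable_funPT _ _ _ _ f). Qed.

Definition mfunR (f : Lf) : {mfun T >-> measurableTypeR R} :=
  mfun_Sub (measurable_funR f).

Lemma mfun_class_finite (f : Lf) :
  finite_norm mu p (mfun_class (mfunR f) : T -> R).
Proof.
rewrite /finite_norm (@ae_eq_Lnorm _ f)//.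
- exact: Lfunction_finite.
- exact: (@measurable_funPT _ _ _ _ (repr (mfun_class (mfunR f)))).
- exact: mfun_class_ae.
Qed.

Definition Lspace_class (f : Lf) : Lp :=
  LebesgueSpace.Pack (LebesgueSpace.Class
    (isFinLebesgue.Build _ _ _ mu p p1 (mfun_class (mfunR f))
       (mfun_class_finite f))).

Lemma Lspace_class_ae (f : Lf) : (Lspace_class f : T -> R) = f %[ae mu].
Proof. exact: mfun_class_ae. Qed.

Lemma Lspace_eqP (F G : Lp) : (F : T -> R) = G %[ae mu] -> F = G.
Proof.
move=> FG.
have FGs : LebesgueSpace.sort F = LebesgueSpace.sort G.
  have /eqP : repr (LebesgueSpace.sort F) = repr (LebesgueSpace.sort G)
      %[mod {mfun_ mu, T >-> measurableTypeR R}]%qT.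
    by apply/eqmodP/asboolP.
  by rewrite !reprK => /eqP.
case: F G FGs {FG} => [F [[Ff]]] [G [[Gf]]] /= FG.
by subst G; rewrite (Prop_irrelevance Ff Gf).
Qed.

Lemma Lspace_class_eq (f g : Lf) :
  (f : T -> R) = g %[ae mu] -> Lspace_class f = Lspace_class g.
Proof.
move=> fg; apply: Lspace_eqP.
apply: ae_eq_trans (Lspace_class_ae f) _.
by apply: ae_eq_trans fg _; apply: ae_eq_sym; exact: Lspace_class_ae.
Qed.

Lemma Lspace_reprK : cancel Lspace_repr Lspace_class.
Proof. by move=> F; apply: Lspace_eqP; exact: Lspace_class_ae. Qed.

Lemma Lspace_classD (f g : Lf) :
  Lspace_class (Lspace_repr (Lspace_class f) + Lspace_repr (Lspace_class g)) =
  Lspace_class (f + g).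
Proof.
apply: Lspace_class_eq; apply: filterS2 (Lspace_class_ae f) (Lspace_class_ae g).
move=> x fx gx xT.
change (Lspace_class f x + Lspace_class g x = f x + g x).
by rewrite fx// gx.
Qed.

Lemma Lspace_classN (f : Lf) :
  Lspace_class (- Lspace_repr (Lspace_class f)) = Lspace_class (- f).
Proof.
apply: Lspace_class_eq; apply: filterS (Lspace_class_ae f) => x fx xT.
change (- Lspace_class f x = - f x).
by rewrite fx.
Qed.

Lemma Lspace_classZ (a : R) (f : Lf) :
  Lspace_class (a *: Lspace_repr (Lspace_class f)) = Lspace_class (a *: f).
Proof.
apply: Lspace_class_eq; apply: filterS (Lspace_class_ae f) => x fx xT.
change (a *: Lspace_class f x = a *: f x).
by rewrite fx.
Qed.

HB.instance Definition _ := gen_eqMixin Lp.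
HB.instance Definition _ := gen_choiceMixin Lp.

Definition Lspace_add (F G : Lp) := Lspace_class (Lspace_repr F + Lspace_repr G).
Definition Lspace_opp (F : Lp) := Lspace_class (- Lspace_repr F).
Definition Lspace_scale (a : R) (F : Lp) := Lspace_class (a *: Lspace_repr F).
Definition Lspace_norm (F : Lp) := fine ('N[mu]_p[EFin \o (F : T -> R)]).

Let addE f g :
  Lspace_add (Lspace_class f) (Lspace_class g) = Lspace_class (f + g).
Proof. exact: Lspace_classD. Qed.

Let Lspace_addA : associative Lspace_add.
Proof.
move=> F G H; rewrite -(Lspace_reprK F) -(Lspace_reprK G) -(Lspace_reprK H).
by rewrite !addE addrA.
Qed.

Let Lspace_addC : commutative Lspace_add.
Proof. by move=> F G; rewrite /Lspace_add addrC. Qed.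

Let Lspace_add0 : left_id (Lspace_class 0) Lspace_add.
Proof. by move=> F; rewrite -(Lspace_reprK F) addE add0r. Qed.

Let Lspace_addN : left_inverse (Lspace_class 0) Lspace_opp Lspace_add.
Proof.
move=> F; rewrite -(Lspace_reprK F) [Lspace_opp _]Lspace_classN.
by rewrite addE addNr.
Qed.

HB.instance Definition _ := GRing.isZmodule.Build Lp
  Lspace_addA Lspace_addC Lspace_add0 Lspace_addN.

Let scaleE a f : Lspace_scale a (Lspace_class f) = Lspace_class (a *: f).
Proof. exact: Lspace_classZ. Qed.

Let Lspace_scaleA a b F :
  Lspace_scale a (Lspace_scale b F) = Lspace_scale (a * b) F.
Proof. by rewrite -(Lspace_reprK F) !scaleE scalerA. Qed.

Let Lspace_scale1 : left_id 1 Lspace_scale.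
Proof. by move=> F; rewrite -(Lspace_reprK F) scaleE scale1r. Qed.

Let Lspace_scaleDr : right_distributive Lspace_scale +%R.
Proof.
move=> a F G; rewrite -(Lspace_reprK F) -(Lspace_reprK G).
by rewrite [_ + _ in LHS]addE !scaleE [RHS]addE scalerDr.
Qed.

Let Lspace_scaleDl F : {morph Lspace_scale^~ F : a b / a + b}.
Proof.
move=> a b; rewrite -(Lspace_reprK F) !scaleE.
by rewrite [RHS]addE scalerDl.
Qed.

HB.instance Definition _ := GRing.Zmodule_isLmodule.Build R Lp
  Lspace_scaleA Lspace_scale1 Lspace_scaleDr Lspace_scaleDl.

Let normE (f : Lf) :
  Lspace_norm (Lspace_class f) = fine ('N[mu]_p[EFin \o f]).
Proof.
rewrite /Lspace_norm; congr fine; apply: ae_eq_Lnorm => //.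
- exact: (@measurable_funPT _ _ _ _ (repr (mfun_class (mfunR f)))).
- exact: Lspace_class_ae.
Qed.

Let Lspace_normD F G : Lspace_norm (F + G) <= Lspace_norm F + Lspace_norm G.
Proof.
rewrite -(Lspace_reprK F) -(Lspace_reprK G) [_ + _ in leLHS]addE !normE.
exact: ler_LnormD.
Qed.

Let Lspace_normZ a F : Lspace_norm (a *: F) = `|a| * Lspace_norm F.
Proof.
rewrite -(Lspace_reprK F) [_ *: _]scaleE !normE.
by apply: EFin_inj; rewrite EFinM !finite_norm_fine LnormZ.
Qed.

Let Lspace_norm_eq0 F : Lspace_norm F = 0 -> F = 0.
Proof.
rewrite -(Lspace_reprK F) normE => /fine_Lnormr_eq0 F0.
exact: Lspace_class_eq.
Qed.

HB.instance Definition _ := @Lmodule_isNormed.Build R Lp Lspace_norm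
  Lspace_normD Lspace_normZ Lspace_norm_eq0.

End LspaceNormed.

Section RandomElements.
Context d (T : measurableType d) (R : realType) (P : probability T R).

Definition borel (E : topologicalType) : set (set E) := <<s @open E >>.

Definition random_element (E : topologicalType) (Y : T -> E) :=
  forall A, borel A -> measurable (Y @^-1` A).

Definition independent_wrt (E E' : Type) (S : set (set E)) (S' : set (set E'))
    (Y : T -> E) (Z : T -> E') :=
  forall A B, S A -> S' B ->
    (P ((Y @^-1` A) `&` (Z @^-1` B)) = P (Y @^-1` A) * P (Z @^-1` B))%E.

Definition same_law_wrt (E : Type) (S : set (set E)) (Y Z : T -> E) :=
  forall A, S A -> P (Y @^-1` A) = P (Z @^-1` A).

(* The degenerate law is treated separately because the library's
   [normal_prob 0 0] is not the Dirac measure at 0. *)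
Definition centered_normal (Z : T -> R) :=
  P (Z @^-1` [set 0]) = 1%E \/
  exists2 s : R, 0 < s &
    forall A : set R, measurable A -> P (Z @^-1` A) = normal_prob 0 s A.

Definition centered_gaussian (E : normedModType R) (Y : T -> E) :=
  random_element Y /\
  forall phi : {linear E -> R^o}, continuous phi -> centered_normal (phi \o Y).

End RandomElements.

Definition cvg_in_distribution d d' (T : measurableType d)
    (T' : measurableType d') (R : realType) (P : probability T R)
    (P' : probability T' R) (E : topologicalType)
    (Y : nat -> T -> E) (Z : T' -> E) :=
  [/\ forall n, random_element (Y n), random_element Z &
      forall h : E -> R, continuous h -> bounded_fun h ->
        'E_P[h \o Y n] @[n --> \oo] --> 'E_P'[h \o Z] ]%E.

Section Sequences.
Context (R : realType).

(* The product sigma-algebra, generated by the coordinate maps. *)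
Definition path_measurable : set (set (int -> R)) :=
  <<s [set B | exists k : int, exists2 A : set R,
         measurable A & B = [set x | A (x k)]] >>.

Definition shift (x : int -> R) : int -> R := fun k => x (k + 1).

Context d (T : measurableType d) (P : probability T R).

Definition trajectory (X : int -> {RV P >-> R}) (w : T) : int -> R :=
  fun k => X k w.

Definition stationary (X : int -> {RV P >-> R}) :=
  same_law_wrt P path_measurable (shift \o trajectory X) (trajectory X).

Definition ergodic (X : int -> {RV P >-> R}) :=
  forall B, path_measurable B -> shift @^-1` B = B ->
    P (trajectory X @^-1` B) = 0%E \/ P (trajectory X @^-1` B) = 1%E.

Definition independent_sequences (X Y : int -> {RV P >-> R}) :=
  independent_wrt P path_measurable path_measurable
    (trajectory X) (trajectory Y).

End Sequences.

Section Empirical.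
Context (R : realType).

(* A probability measure for n > 0, and the null measure for n = 0. *)
Definition empirical (x : int -> R) (n : nat) : {measure set R -> \bar R} :=
  mscale (n%:R^-1)%:nng (msum (fun k : nat => \d_(x k.+1%:Z)) n).

Definition empirical_cdf (x : int -> R) (n : nat) (t : R) : R :=
  fine (empirical x n `]-oo, t]%classic).

Definition empirical_process (F : R -> R) (x : int -> R) (n : nat) (t : R) : R :=
  Num.sqrt n%:R * (empirical_cdf x n t - F t).

Definition coupling (mu nu : {measure set R -> \bar R})
    (pi : probability (R * R)%type R) :=
  forall A : set R, measurable A ->
    pi (A `*` setT) = mu A /\ pi (setT `*` A) = nu A.

(* Used on probability measures: [mu] and [nu] are only required to be measures
   so that [empirical] is covered without the proviso n > 0. *)
Definition W1 (mu nu : {measure set R -> \bar R}) : \bar R :=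
  ereal_inf [set (\int[pi]_z (`|z.1 - z.2|)%:E)%E | pi in coupling mu nu].

End Empirical.

Notation L1 R := (LspaceType1 (@lebesgue_measure R)).

Definition toL1 (R : realType) (f : R -> R)
    (hf : f \in Lfun (@lebesgue_measure R) 1) : L1 R :=
  Lspace_class (Lfun_Sub (lexx 1%E) hf).

(* Both one-sided series converge, which is weaker than absolute summability. *)
Definition is_sum_int (R : realType) (c : int -> R) (s : R) :=
  exists a b : R, [/\ series (fun n : nat => c n%:Z) @ \oo --> a,
    series (fun n : nat => c (- n.+1%:Z)) @ \oo --> b & s = a + b].

(* Equating the expectations and the covariance with reals states that they
   exist and are finite. *)
Definition long_run_covariance d d' (T : measurableType d)
    (T' : measurableType d') (R : realType) (P : probability T R)
    (P' : probability T' R) (X : int -> {RV P >-> R}) (F : R -> R)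
    (G : T' -> L1 R) :=
  let leb := @lebesgue_measure R in
  forall f g : R -> R,
    measurable_fun setT f -> bounded_fun f ->
    measurable_fun setT g -> bounded_fun g ->
  exists (c : int -> R) (s : R),
  [/\ forall k : int,
        'E_P[fun w => (\int[(leb \x leb)%E]_z
               (f z.1 * g z.2 * ((X 0 w <= z.1)%R%:R - F z.1)
                              * ((X k w <= z.2)%R%:R - F z.2)))%R]%E = (c k)%:E,
      is_sum_int c s &
      covariance P' (fun w => \int[leb]_t (f t * G w t))
                    (fun w => \int[leb]_t (g t * G w t)) = s%:E].

(* Main.v *)
Require Import Defs.
From HB Require Import structures.
From mathcomp Require Import all_boot all_order all_algebra.
From mathcomp Require Import all_classical all_reals all_analysis.
From mathcomp Require Import measurable_realfun.

Set Implicit Arguments.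
Unset Strict Implicit.
Unset Printing Implicit Defensive.

Import Order.TTheory GRing.Theory Num.Theory.
Import numFieldNormedType.Exports.

Local Open Scope classical_set_scope.
Local Open Scope ring_scope.

(* The map (f, g) |-> |f - g|_1 is continuous on L^1 x L^1, so by the continuous
   mapping theorem it suffices that sqrt n * W_1 of the two empirical measures
   equals the L^1 distance of the two empirical processes, i.e. that W_1 is the
   L^1 distance of the distribution functions. Writing |x - y| as the integral
   over t of |1{x <= t} - 1{y <= t}|, Tonelli's theorem bounds the cost of any
   coupling from below by this distance. Pairing the order statistics of the two
   samples attains the bound, since at each t the differences of indicators then
   all have the same sign. *)

(** * Continuous mapping theorem *)

Lemma borel_preimage (E E' : topologicalType) (phi : E -> E') :
  continuous phi -> forall A, borel A -> borel (phi @^-1` A).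
Proof.
(* The sets whose preimage under [phi] is Borel form a sigma-algebra, and by continuity it contains
   the open sets. *)
move=> /continuousP phi_cont; apply: smallest_sub.
  have := sigma_algebra_image phi (smallest_sigma_algebra setT (@open E)).
  by rewrite /image_set_system/=; under eq_fun do rewrite setTI.
by move=> U oU; apply: sub_sigma_algebra; exact: phi_cont.
Qed.

Lemma continuous_mapping d d' (T : measurableType d) (T' : measurableType d')
    (R : realType) (P : probability T R) (P' : probability T' R)
    (E E' : topologicalType) (phi : E -> E') (Y : nat -> T -> E) (Z : T' -> E) :
  continuous phi -> cvg_in_distribution P P' Y Z ->
  cvg_in_distribution P P' (fun n => phi \o Y n) (phi \o Z).
Proof.
move=> phi_cont [mY mZ YZ]; split.
- by move=> n A bA; exact: (mY n _ (borel_preimage phi_cont bA)).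
- by move=> A bA; exact: (mZ _ (borel_preimage phi_cont bA)).
- move=> h h_cont h_bnd; apply: (YZ (h \o phi)).
    by move=> x; apply: continuous_comp; [exact: phi_cont|exact: h_cont].
  by case: h_bnd => M [Mreal hM]; exists M; split=> // x /hM hx y _; exact: hx.
Qed.

(** * The norm of L^1 classes as an integral of representatives *)

Section L1_distance.
Context (R : realType).
Local Notation leb := (@lebesgue_measure R).

Lemma measurable_L1 (F : L1 R) : measurable_fun setT (F : R -> R).
Proof. exact: (@measurable_funPT _ _ _ _ (repr (LebesgueSpace.sort F))). Qed.

(** The representative chosen for the class [F - G] agrees with the pointwise difference only almost
    everywhere, which is enough for the norm. *)
Lemma L1_normB (F G : L1 R) : `|F - G| = \int[leb]_t `|F t - G t|.
Proof.
have FGae : (F - G : R -> R) = (fun t => F t - G t) %[ae leb].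
  apply: ae_eq_trans (Lspace_class_ae _) _.
  apply: filterS (Lspace_class_ae (- Lspace_repr G)) => t Gt _.
  by rewrite -[F t - G t]/(F t + (- Lspace_repr G) t) -Gt.
change (fine ('N[leb]_1[EFin \o ((F - G)%R : R -> R)])%E =
  \int[leb]_t `|F t - G t|).
rewrite (ae_eq_Lnorm (lexx 1%E) _ _ FGae) ?Lnorm1//.
- exact: measurable_L1.
- by apply: measurable_funB; exact: measurable_L1.
Qed.

Lemma toL1_normB (f g : R -> R) (hf : f \in Lfun leb 1) (hg : g \in Lfun leb 1) :
  `|toL1 hf - toL1 hg| = \int[leb]_t `|f t - g t|.
Proof.
have mf h (hh : h \in Lfun leb 1) : measurable_fun setT (h : R -> R).
  by move/Lfun1_integrable : hh => /measurable_int/measurable_EFinP.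
rewrite L1_normB /Rintegral; congr fine; apply: ae_eq_integral => //.
- apply/measurable_EFinP; apply: measurableT_comp => //.
  by apply: measurable_funB; exact: measurable_L1.
- apply/measurable_EFinP; apply: measurableT_comp => //.
  by apply: measurable_funB; exact: mf.
- have fE := Lspace_class_ae (Lfun_Sub (lexx 1%E) hf).
  have gE := Lspace_class_ae (Lfun_Sub (lexx 1%E) hg).
  by apply: filterS2 fE gE => t ft gt _; rewrite ft// gt.
Qed.

End L1_distance.

(** * Lower bound for the cost of a coupling on the line *)

Section W1_line.
Context (R : realType).
Local Notation leb := (@lebesgue_measure R).
Implicit Types (x y t : R).

Local Notation ind x t := ((x <= t)%R%:R : R).

Lemma measurable_le_ind d (T : measurableType d) (f g : T -> R) :
  measurable_fun setT f -> measurable_fun setT g ->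
  measurable_fun setT (fun z => ind (f z) (g z)).
Proof.
move=> mf mg; apply: (measurableT_comp (f := fun b : bool => b%:R : R)) => //.
exact: measurable_fun_ler.
Qed.

Lemma measurable_dist_ind d (T : measurableType d) (f g h : T -> R) :
  measurable_fun setT f -> measurable_fun setT g -> measurable_fun setT h ->
  measurable_fun setT (fun z => `|ind (f z) (h z) - ind (g z) (h z)|%:E).
Proof.
move=> mf mg mh; apply/measurable_EFinP; apply: measurableT_comp => //.
by apply: measurable_funB; exact: measurable_le_ind.
Qed.

Lemma integral_dist_ind x y :
  (\int[leb]_t `|ind x t - ind y t|%:E = `|x - y|%:E)%E.
Proof.
wlog xy : x y / x <= y => [wl|].
  have [/wl//|/ltW/wl] := leP x y.
  by rewrite distrC => <-; apply: eq_integral => t _; rewrite distrC.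
(* For x <= y the two indicators differ exactly when x <= t < y. *)
transitivity (\int[leb]_t (\1_(`[x, y[%classic : set R) t)%:E)%E; last first.
  rewrite integral_indic// setIT.
  have := lebesgue_measure_itv `[x, y[.
  move=> /= ->; rewrite /= lte_fin.
  rewrite ler0_norm ?subr_le0// opprB -EFinB.
  by case: ltgtP xy => // -> _; rewrite subrr.
apply: eq_integral => t _; rewrite indicE mem_setE in_itv/=.
have [xt|tx] := leP x t; have [yt|ty] := leP y t => /=.
- by rewrite subrr normr0.
- by rewrite subr0 normr1.
- by have := le_lt_trans (le_trans xy yt) tx; rewrite ltxx.
- by rewrite subrr normr0.
Qed.

Lemma coupling_integral_cdf (mu nu : {measure set R -> \bar R})
    (pi : probability (R * R)%type R) : coupling mu nu pi ->
  (\int[leb]_t `|fine (mu `]-oo, t]%classic) - fine (nu `]-oo, t]%classic)|%:E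
   <= \int[pi]_z `|z.1 - z.2|%:E)%E.
Proof.
move=> cpl.
have mi (f : R * R -> R) : measurable_fun setT f ->
    measurable_fun setT (fun p : (R * R) * R => (ind (f p.1) p.2)%:E).
  move=> mf; apply/measurable_EFinP; apply: measurable_le_ind => //.
  exact: measurableT_comp.
have indE (f : R * R -> R) t z :
    \1_(f @^-1` `]-oo, t]%classic) z = ind (f z) t.
  by rewrite indicE; congr (nat_of_bool _)%:R;
    apply/idP/idP; rewrite inE/= in_itv.
have ind_int (f : R * R -> R) t : measurable_fun setT f ->
    pi.-integrable setT (fun z => (ind (f z) t)%:E).
  move=> mf; rewrite (_ : (fun z => _) = EFin \o \1_(f @^-1` `]-oo, t]%classic)).
    apply: integrable_indic; rewrite -[X in measurable X]setTI.
    by apply: mf => //; exact: measurable_itv.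
  by apply/funext => z /=; rewrite indE.
have cdfE (f : R * R -> R) t : measurable_fun setT f ->
    (\int[pi]_z (ind (f z) t)%:E = pi (f @^-1` `]-oo, t]%classic))%E.
  move=> mf; rewrite -[f @^-1` _]setIT -integral_indic//.
    by apply: eq_integral => z _; rewrite indE.
  rewrite -[X in measurable X]setTI.
  by apply: mf => //; exact: measurable_itv.
(* The marginal conditions turn both distribution functions into expectations of indicators under
   the single measure [pi]. *)
have FE t : (`|fine (mu `]-oo, t]%classic) - fine (nu `]-oo, t]%classic)|%:E =
    `|\int[pi]_z (ind z.1 t)%:E - \int[pi]_z (ind z.2 t)%:E|)%E.
  rewrite !cdfE// -[pi (fst @^-1` _)]fineK ?fin_num_measure//; last first.
    by rewrite -setXT; exact: measurableX.
  rewrite -[pi (snd @^-1` _)]fineK ?fin_num_measure//; last first.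
    by rewrite -setTX; exact: measurableX.
  have [<- _] := cpl _ (measurable_itv `]-oo, t]).
  have [_ <-] := cpl _ (measurable_itv `]-oo, t]).
  by rewrite setXT setTX.
under eq_integral do rewrite FE.
under [leRHS]eq_integral do rewrite -integral_dist_ind.
have mD : measurable_fun setT (fun p : (R * R) * R =>
    `|ind p.1.1 p.2 - ind p.1.2 p.2|%:E).
  by apply: measurable_dist_ind; do ?exact: measurableT_comp.
rewrite [leRHS](_ : _ = \int[leb]_t \int[pi]_z `|ind z.1 t - ind z.2 t|%:E)%E;
  last first.
  apply: (fubini_tonelli (m1 := pi) (m2 := leb) _ mD) => z.
  by rewrite lee_fin.
apply: ge0_le_integral => //.
- apply: measurableT_comp => //; apply: emeasurable_funB.
    apply: (measurable_fun_fubini_tonelli_G (m1 := pi) _ (mi fst measurable_fst)).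
    by move=> z; rewrite lee_fin.
  apply: (measurable_fun_fubini_tonelli_G (m1 := pi) _ (mi snd measurable_snd)).
  by move=> z; rewrite lee_fin.
- by apply: (measurable_fun_fubini_tonelli_G (m1 := pi) _ mD) => z; rewrite lee_fin.
(* After the exchange of integrals, the bound holds for each t: the modulus of an integral is at
   most the integral of the modulus. *)
- move=> t _; rewrite -integralB_EFin ?ind_int//.
  apply: (le_trans (le_abse_integral _ _ _)) => //.
  by apply: emeasurable_funB; apply: measurable_int; exact: ind_int.
Qed.

End W1_line.

(** * Optimal coupling of empirical measures by order statistics *)

Section W1_empirical.
Context (R : realType).
Local Notation leb := (@lebesgue_measure R).
Implicit Types (x y : int -> R) (t : R) (n : nat).

Local Notation ind x t := ((x <= t)%R%:R : R).

Lemma empirical_cdfE x n t :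
  empirical_cdf x n t = n%:R^-1 * \sum_(k < n) ind (x k.+1%:Z) t.
Proof.
rewrite /empirical_cdf /empirical /= /mscale /= /msum /=.
under eq_bigr do rewrite diracE mem_setE in_itv/=.
by rewrite sumEFin.
Qed.

(** The sample is x_1, ..., x_n, while positions in the sorted list start at 0. The default 0 of
    [nth] is never read for k < n. *)
Definition order_statistics x n : seq R :=
  sort <=%R [seq x k.+1%:Z | k <- iota 0 n].

Local Notation xord x n k := (nth 0 (order_statistics x n) k).

Lemma size_order_statistics x n : size (order_statistics x n) = n.
Proof. by rewrite size_sort size_map size_iota. Qed.

(** Sorting is a permutation. This serves both for the marginals of the sorted pairing and for the
    empirical distribution functions. *)
Lemma sum_order_statistics (V : nmodType) x n (g : R -> V) :
  \sum_(k < n) g (xord x n k) = \sum_(k < n) g (x k.+1%:Z).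
Proof.
transitivity (\sum_(a <- order_statistics x n) g a).
  by rewrite (big_nth 0) size_order_statistics big_mkord.
rewrite (perm_big _ (permEl (perm_sort _ _))) big_map.
by rewrite -(big_mkord xpredT (fun k => g (x k.+1%:Z))) /index_iota subn0.
Qed.

Lemma le_order_statistics x n k l : (k <= l < n)%N ->
  xord x n k <= xord x n l.
Proof.
move=> /andP[kl ln].
apply: (sorted_leq_nth le_trans le_refl) => //; rewrite ?inE.
- exact: (sort_sorted le_total).
- by rewrite size_order_statistics (leq_ltn_trans kl).
- by rewrite size_order_statistics.
Qed.

(* For a fixed [t] both families of indicators are nonincreasing in [k], so all
   their differences have the same sign. *)
Lemma sum_dist_ind_order_statistics x y n t :
  \sum_(k < n) `|ind (xord x n k) t - ind (xord y n k) t| =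
  `|\sum_(k < n) (ind (xord x n k) t - ind (xord y n k) t)|.
Proof.
wlog xy : x y / forall k : 'I_n, ind (xord x n k) t <= ind (xord y n k) t.
  move=> wl.
  have [/forallP/wl//|] :=
    boolP [forall k : 'I_n, ind (xord x n k) t <= ind (xord y n k) t].
  move=> /forallPn[k]; rewrite -ltNge => yx.
  under eq_bigr do rewrite distrC.
  under [in RHS]eq_bigr do rewrite -opprB.
  rewrite sumrN normrN; apply: wl => l.
  move: yx; rewrite ltr_nat ler_nat.
  have [xkt|] := leP (xord x n k) t; have [|tyk] := leP (xord y n k) t => //= _.
  have [ylt|] := leP (xord y n l) t; have [|txl] := leP (xord x n l) t => //=.
  (* An opposite sign at l would mean y_l <= t < x_l, while x_k <= t < y_k. Monotonicity of the y's
     excludes this if k <= l, that of the x's if l < k. *)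
  have [kl|lk] := leqP k l.
    have := le_lt_trans ylt tyk.
    by rewrite ltNge le_order_statistics// kl ltn_ord.
  have := le_lt_trans xkt txl.
  by rewrite ltNge le_order_statistics// ltnW//= ltn_ord.
rewrite ler0_norm; last by apply: sumr_le0 => k _; rewrite subr_le0.
by rewrite -sumrN; apply: eq_bigr => k _; rewrite ler0_norm// subr_le0.
Qed.

(** Serves to give a measure of total mass 1 the structure of a probability without changing its
    values. *)
Lemma mnormalize_id d (T : measurableType d) (m : {measure set T -> \bar R})
    (P : probability T R) : m setT = 1%E -> mnormalize m P = m.
Proof.
move=> m1; rewrite /mnormalize m1 onee_eq0/=.
by apply/funext => A; rewrite invr1 mule1.
Qed.

(** Stated on any space, so as to cover both the empirical measures on the line and their coupling
    in the plane. *)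
Definition average_dirac d (T : measurableType d) (z : nat -> T) n :
    {measure set T -> \bar R} :=
  mscale (n%:R^-1)%:nng (msum (fun k => \d_(z k)) n).

Lemma average_diracE d (T : measurableType d) (z : nat -> T) n A :
  average_dirac z n A = (n%:R^-1 * \sum_(k < n) (z k \in A)%:R)%:E.
Proof. by rewrite /average_dirac /= /mscale /= /msum /= EFinM -sumEFin. Qed.

Lemma ge0_integral_average_dirac d (T : measurableType d) (z : nat -> T) n
    (f : T -> \bar R) : measurable_fun setT f -> (forall a, 0 <= f a)%E ->
  (\int[average_dirac z n]_a f a = (n%:R^-1)%:E * \sum_(k < n) f (z k))%E.
Proof.
move=> mf f0; rewrite ge0_integral_mscale// ge0_integral_measure_sum//.
congr (_ * _)%E; apply: eq_bigr => k _.
by rewrite integral_dirac// diracT mul1e.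
Qed.

Lemma average_dirac_setT d (T : measurableType d) (z : nat -> T) n :
  (0 < n)%N -> average_dirac z n setT = 1%E.
Proof.
move=> n0; rewrite average_diracE; under eq_bigr do rewrite in_setT.
by rewrite sumr_const card_ord mulVf// pnatr_eq0 -lt0n.
Qed.

Lemma coupling_order_statistics x y n (pi : probability (R * R)%type R) :
  pi = average_dirac (fun k => (xord x n k, xord y n k)) n :> (set _ -> \bar R) ->
  coupling (empirical x n) (empirical y n) pi.
Proof.
have empiricalE (u : int -> R) A : empirical u n A =
    (n%:R^-1 * \sum_(k < n) (xord u n k \in A)%:R)%:E.
  by rewrite (sum_order_statistics _ _ (fun a => (a \in A)%:R))
    -(average_diracE (fun k => u k.+1%:Z)).
move=> piE A mA; rewrite !empiricalE piE !average_diracE.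
by split; congr (_ * _)%:E; apply: eq_bigr => k _;
  rewrite in_setX in_setT ?andbT.
Qed.

(** For n = 0 both measures are null, so no probability couples them and the infimum is infinite;
    hence the condition on n. *)
Lemma W1_empirical x y n : (0 < n)%N ->
  W1 (empirical x n) (empirical y n) =
  (\int[leb]_t `|empirical_cdf x n t - empirical_cdf y n t|%:E)%E.
Proof.
move=> n0; apply/eqP; rewrite eq_le; apply/andP; split; last first.
  by apply: le_ereal_inf_tmp => _ [pi /coupling_integral_cdf xy_pi <-].
pose z k := (xord x n k, xord y n k).
(* The Dirac mass is a mere fallback of [mnormalize]; the average already has mass 1. *)
pose pi : probability (R * R)%type R :=
  mnormalize (average_dirac z n) \d_((0, 0) : (R * R)%type).
have piE : pi = average_dirac z n :> (set _ -> \bar R).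
  by apply: mnormalize_id; exact: average_dirac_setT.
apply: ge_ereal_inf; exists (\int[pi]_w `|w.1 - w.2|%:E)%E.
  by exists pi => //; exact: coupling_order_statistics.
rewrite (eq_measure_integral (average_dirac z n)); last by move=> A _ _; rewrite -piE.
rewrite [leLHS]ge0_integral_average_dirac//; last first.
  apply/measurable_EFinP; apply: measurableT_comp => //.
  exact: measurable_funB.
rewrite /z /=; under eq_bigr do rewrite -integral_dist_ind.
have mD a b : measurable_fun setT (fun t => `|ind a t - ind b t|%:E).
  exact: measurable_dist_ind.
rewrite -ge0_integral_sum//.
rewrite -(ge0_integralZl leb measurableT (f := fun t =>
    \sum_(k < n) `|ind (xord x n k) t - ind (xord y n k) t|%:E)%E).
(* Equality holds for each t: the common sign lets the modulus leave the sum, and reordering then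
   recovers the empirical distribution functions. *)
- rewrite le_eqVlt; apply/orP; left; apply/eqP; apply: eq_integral => t _.
  rewrite sumEFin sum_dist_ind_order_statistics -EFinM !empirical_cdfE -mulrBr.
  rewrite normrM ger0_norm// sumrB.
  by rewrite !(sum_order_statistics _ _ (fun a => ind a t)).
- by apply: emeasurable_sum => k; exact: mD.
- by move=> t _; apply: sume_ge0 => k _; rewrite lee_fin.
- by rewrite lee_fin.
- by move=> k; exact: mD.
Qed.

End W1_empirical.

(** * Scaling by sqrt n and conclusion *)

(** Infinite [u] is covered, since [fine] sends both infinities to 0; so sqrt n passes through an
    integral without a finiteness proof. *)
Lemma fineZl (R : realType) (a : R) (u : \bar R) :
  fine (a%:E * u)%E = a * fine u.
Proof.
case: u => [r//| |] /=; have [a0|a0|->] := ltgtP a 0; rewrite ?mulr0 ?mul0e//.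
- by rewrite lt0_muley.
- by rewrite gt0_muley.
- by rewrite lt0_muleNy.
- by rewrite gt0_muleNy.
Qed.

Lemma measurable_empirical_cdf (R : realType) (x : int -> R) n :
  measurable_fun setT (empirical_cdf x n).
Proof.
rewrite (funext (empirical_cdfE x n)); apply: measurable_funM => //.
by apply: measurable_sum => k; exact: measurable_le_ind.
Qed.

Lemma W1_empirical_process (R : realType) (F : R -> R) (x y : int -> R) n :
  Num.sqrt n%:R * fine (W1 (empirical x n) (empirical y n)) =
  \int[@lebesgue_measure R]_t
    `|empirical_process F x n t - empirical_process F y n t|.
Proof.
transitivity (Num.sqrt n%:R *
    \int[@lebesgue_measure R]_t `|empirical_cdf x n t - empirical_cdf y n t|).
  (* At n = 0 the factor sqrt 0 makes both sides vanish, whatever the value of [W1]. *)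
  have [->|n0] := posnP n; first by rewrite sqrtr0 !mul0r.
  by rewrite W1_empirical.
rewrite /Rintegral -fineZl -ge0_integralZl//.
- congr fine; apply: eq_integral => t _; rewrite -EFinM /empirical_process.
  (* The centring [F] cancels in the difference of the two processes. *)
  by rewrite -mulrBr [in RHS]opprB addrA subrK normrM ger0_norm// sqrtr_ge0.
- apply/measurable_EFinP; apply: measurableT_comp => //.
  by apply: measurable_funB; exact: measurable_empirical_cdf.
Qed.

Theorem theorem3 (R : realType)
    (d : measure_display) (T : measurableType d) (P : probability T R)
    (Xi Xj : int -> {RV P >-> R}) (F : R -> R)
    (Xi_stationary : stationary Xi) (Xi_ergodic : ergodic Xi)
    (Xj_stationary : stationary Xj) (Xj_ergodic : ergodic Xj)
    (X_independent : independent_sequences Xi Xj)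
    (Xi_cdf : forall k t, cdf (Xi k) t = (F t)%:E)
    (Xj_cdf : forall k t, cdf (Xj k) t = (F t)%:E)
    (Si_L1 : forall n w, empirical_process F (trajectory Xi w) n
                           \in Lfun (@lebesgue_measure R) 1)
    (Sj_L1 : forall n w, empirical_process F (trajectory Xj w) n
                           \in Lfun (@lebesgue_measure R) 1)
    (d' : measure_display) (T' : measurableType d') (P' : probability T' R)
    (Gi Gj : T' -> L1 R)
    (G_cvg : cvg_in_distribution P P'
               (fun n w => (toL1 (Si_L1 n w), toL1 (Sj_L1 n w)))
               (fun w => (Gi w, Gj w)))
    (G_gaussian : centered_gaussian P' (fun w => (Gi w, Gj w)))
    (G_independent : independent_wrt P' (@borel (L1 R)) (@borel (L1 R)) Gi Gj)
    (G_copies : same_law_wrt P' (@borel (L1 R)) Gi Gj)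
    (Gi_covariance : long_run_covariance P' Xi F Gi)
    (Gj_covariance : long_run_covariance P' Xj F Gj) :
  cvg_in_distribution P P'
    (fun n w => Num.sqrt n%:R *
       fine (W1 (empirical (trajectory Xi w) n) (empirical (trajectory Xj w) n)))
    (fun w => \int[@lebesgue_measure R]_t `|Gi w t - Gj w t|).
Proof.
pose dist (z : L1 R * L1 R) : R := `|z.1 - z.2|.
have dist_cont : continuous dist.
  move=> z; apply: cvg_norm; exact: sub_continuous.
have := continuous_mapping dist_cont G_cvg.
(* It remains to identify, pointwise in [w], the image sequence with the scaled distance and the
   image limit with the integral. *)
congr (cvg_in_distribution _ _ _ _).
- apply/funext => n; apply/funext => w /=.
  by rewrite /dist/= toL1_normB (W1_empirical_process F).
- by apply/funext => w; rewrite /dist /= L1_normB.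
Qed.
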